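(* Let $\Sigma$ be a signed graph on $n$ vertices whose underlying graph is finite, simple, undirected and connected. Let $\bigwedge^{k}\Sigma$ denote its exterior $k$th power. (a) For each integer $k$ with $2 \le k \le n-2$: $\bigwedge^{k}\Sigma$ is balanced if and only if either (i) $\Sigma$ is a signed path (i.e. its underlying graph is a path), or (ii) $\Sigma$ is a signed cycle (i.e. its underlying graph is a cycle) that is balanced when $k$ is odd and unbalanced when $k$ is even. (b) For $k = n-1$ (with $n\ge 2$): $\bigwedge^{n-1}\Sigma$ is balanced if and only if each even cycle in $\Sigma$ is positive and each odd cycle in $\Sigma$ is negative.
   Context: A signed graph $\Sigma=(G,\sigma)$ is a finite simple undirected graph $G=(V,E)$ together with a map $\sigma:E\to\{-1,+1\}$. The sign of a cycle is the product of the signs of its edges; a cycle is even or odd according to its length. A signed graph is balanced if all of its cycles are positive, and unbalanced otherwise. Exterior power: let $\Sigma=(G,\sigma)$ be a signed graph on $n$ vertices and $1\le k\le n-1$. Fix a total order $\prec$ on $V$. The vertex set of $\bigwedge^{k}\Sigma$ is $\binom{V}{k}$, the set of $k$-tuples $(u_1,\dots,u_k)\in V^k$ with $u_1\prec\cdots\prec u_k$. Two vertices $u=(u_1,\dots,u_k)$ and $v=(v_1,\dots,v_k)$ are adjacent iff there are a permutation $\pi$ of $\{1,\dots,k\}$ and an index $i$ such that $u_{\pi(j)}=v_j$ for all $j\ne i$ and $u_{\pi(i)}v_i\in E(G)$. The sign of the edge $uv$ in $\bigwedge^{k}\Sigma$ is $\operatorname{sgn}(\pi)\,\sigma(u_{\pi(i)}v_i)$.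 The statement is meant for any choice of the order $\prec$. *)

(* Defs.v *)
From HB Require Import structures.
From mathcomp Require Import all_boot all_order all_algebra all_fingroup.

Set Implicit Arguments.
Unset Strict Implicit.
Unset Printing Implicit Defensive.

Import Order.TTheory GRing.Theory.
Local Open Scope ring_scope.

Record simple_graph (V : finType) := SimpleGraph {
  edge : rel V;
  edge_sym : symmetric edge;
  edge_irr : irreflexive edge
}.

(* The sign of the edge xy is [esign x y]; its values on non-adjacent pairs
   are irrelevant. *)
Record signed_graph (V : finType) := SignedGraph {
  graph :> simple_graph V;
  esign : V -> V -> int;
  esign_sym : forall x y, edge graph x y -> esign x y = esign y x;
  esign_pm1 : forall x y, edge graph x y -> esign x y = 1 \/ esign x y = -1
}.

Definition connected_graph (V : finType) (G : simple_graph V) : Prop :=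
  forall x y : V, connect (edge G) x y.

(* A cycle is given by the cyclic sequence of its distinct vertices, so that
   its length is [size c]. *)
Definition graph_cycle (V : finType) (G : simple_graph V) (c : seq V) : Prop :=
  (2 < size c)%N /\ ucycle (edge G) c.

Definition cycle_sign (V : finType) (S : signed_graph V) (c : seq V) : int :=
  \prod_(x <- c) esign S x (next c x).

Definition balanced (V : finType) (S : signed_graph V) : Prop :=
  forall c, graph_cycle S c -> cycle_sign S c = 1.

Definition unbalanced (V : finType) (S : signed_graph V) : Prop :=
  ~ balanced S.

Definition is_path_graph (V : finType) (G : simple_graph V) : Prop :=
  exists f : 'I_#|V| -> V, bijective f /\
    forall i j, edge G (f i) (f j) = (i.+1 == j :> nat) || (j.+1 == i :> nat).

Definition is_cycle_graph (V : finType) (G : simple_graph V) : Prop :=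
  (2 < #|V|)%N /\
  exists f : 'I_#|V| -> V, bijective f /\
    forall i j, edge G (f i) (f j) = (j == ordS i) || (i == ordS j).

Definition ext_vertex d (V : finOrderType d) (k : nat) : finType :=
  {t : k.-tuple V | sorted <%O t}.

Section ExteriorPower.
Context {d : Order.disp_t} {V : finOrderType d}.
Variables (S : signed_graph V) (k : nat).
Implicit Types (u v : ext_vertex V k) (p : 'S_k * 'I_k).

Definition ent u (i : 'I_k) : V := tnth (val u) i.

Definition ext_witness u v p : bool :=
  [forall j, (j != p.2) ==> (ent u (p.1 j) == ent v j)]
  && edge S (ent u (p.1 p.2)) (ent v p.2).

Definition ext_edge u v : bool := [exists p, ext_witness u v p].

Definition witness_sign u v p : int :=
  (-1) ^+ (p.1 : bool) * esign S (ent u (p.1 p.2)) (ent v p.2).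

(* Adjacent [u] and [v] have a unique witness (see [ext_witness_unique]), so
   the sign does not depend on the choice made by [pick]. *)
Definition ext_sign u v : int :=
  if [pick p | ext_witness u v p] is Some p then witness_sign u v p else 0.

Lemma ent_inj u : injective (ent u).
Proof.
case: u => t st i j; rewrite /ent /= => /eqP.
have ut : uniq t by exact: lt_sorted_uniq st.
by move/eqP/(tuple_uniqP t ut).
Qed.

Lemma ext_witness_notin u v p : ext_witness u v p ->
  forall j, ent u j != ent v p.2.
Proof.
case: p => s i /= /andP[/forallP /= H He] j; apply/eqP => E.
have [ji|ji] := eqVneq ((s^-1)%g j) i.
  by move: He; rewrite -ji permKV E ji edge_irr.
have /implyP/(_ ji)/eqP := H ((s^-1)%g j); rewrite permKV E => /ent_inj ij.
by rewrite -ij eqxx in ji.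
Qed.

Lemma ext_witness_unique u v p q :
  ext_witness u v p -> ext_witness u v q -> p = q.
Proof.
case: p q => [s i] [t j] wp wq.
have ij : i = j.
  apply/eqP; apply: contraT => nij.
  move: (wq) => /andP[/forallP/(_ i)/implyP/(_ nij)/eqP /= E _].
  by have := ext_witness_notin wp (t i); rewrite E eqxx.
subst j; move: wp wq => /andP[/forallP /= Hs _] /andP[/forallP /= Ht _].
have E l : l != i -> s l = t l.
  move=> li; apply: (@ent_inj u).
  by rewrite (eqP (implyP (Hs l) li)) (eqP (implyP (Ht l) li)).
congr (_, _); apply/permP => l; have [->|] := eqVneq l i; last exact: E.
have [ti|ti] := eqVneq ((s^-1)%g (t i)) i; first by rewrite -{1}ti permKV.
by have := E _ ti; rewrite permKV => /perm_inj ti'; rewrite -ti' eqxx in ti.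
Qed.

Lemma ext_signE u v p : ext_witness u v p -> ext_sign u v = witness_sign u v p.
Proof.
move=> w; rewrite /ext_sign; case: pickP => [q wq|/(_ p)]; last by rewrite w.
by rewrite (ext_witness_unique wq w).
Qed.

Lemma ext_witness_sym u v p : ext_witness u v p ->
  ext_witness v u ((p.1^-1)%g, p.1 p.2).
Proof.
case: p => s i /andP[/forallP /= H He]; apply/andP; split=> /=.
  apply/forallP => j; apply/implyP => ji.
  have nj : (s^-1)%g j != i by apply: contraNneq ji => <-; rewrite permKV.
  by rewrite -(eqP (implyP (H _) nj)) permKV.
by rewrite permK edge_sym.
Qed.

Lemma ext_edge_sym : symmetric ext_edge.
Proof.
suff H : forall u v, ext_edge u v -> ext_edge v u.
  by move=> u v; apply/idP/idP; exact: H.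
move=> u v.
by case/existsP => p /ext_witness_sym w; apply/existsP; eexists; exact: w.
Qed.

Lemma ext_edge_irr : irreflexive ext_edge.
Proof.
move=> u; apply/existsP; case=> p w.
by have := ext_witness_notin w p.2; rewrite eqxx.
Qed.

Lemma ext_sign_sym u v : ext_edge u v -> ext_sign u v = ext_sign v u.
Proof.
case/existsP => p w; rewrite (ext_signE w) (ext_signE (ext_witness_sym w)).
rewrite /witness_sign /= odd_permV permK; congr (_ * _).
by apply: esign_sym; case/andP: w.
Qed.

Lemma ext_sign_pm1 u v : ext_edge u v -> ext_sign u v = 1 \/ ext_sign u v = -1.
Proof.
case/existsP => p w; rewrite (ext_signE w) /witness_sign.
have /andP[_ /esign_pm1[]->] := w; case: (odd_perm p.1);
  rewrite ?expr0 ?expr1 ?mulr1 ?mul1r ?mulrNN ?mulr1; by [left|right].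
Qed.

Definition exterior_power : signed_graph (ext_vertex V k) :=
  SignedGraph (graph := SimpleGraph ext_edge_sym ext_edge_irr)
    ext_sign_sym ext_sign_pm1.

End ExteriorPower.

(* Main.v *)
Require Import Defs.
From mathcomp Require Import all_boot all_order all_algebra all_fingroup.
From mathcomp Require Import zify.

Set Implicit Arguments.
Unset Strict Implicit.
Unset Printing Implicit Defensive.

Import Order.TTheory GRing.Theory Num.Theory.
Local Open Scope ring_scope.

(** A signed graph is balanced exactly when its signs are $t(x)t(y)$ for some
    $t : V \to \{\pm1\}$ ([balancedP]).  Applied to the exterior power this turns
    balance into a statement on $k$ labelled particles occupying distinct
    vertices: there must be a $\pm1$-valued function $F$ of the configuration
    that is alternating in the labels and gets multiplied by the sign of an edge
    whenever a particle moves along that edge to a free vertex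
    ([ext_balancedP]).  Everything else is about the existence of such an $F$,
    an alternating potential.

    For $2 \le k \le n-2$, a vertex of degree at least 3 rules out $F$: on a claw
    two particles can be exchanged while every edge is traversed twice
    ([no_claw]).  The condition $k \ge 2$ provides the two particles and
    $k \le n-2$ provides room to park the others off the claw.  A connected graph
    of maximum degree at most 2 is a path or a cycle ([claw_free_path_or_cycle]).

    On a path, particles never change their order along the path.  The sign of
    the permutation sorting the particles, times the product of $t$ over the
    occupied vertices, is therefore an alternating potential, where $t$ switches
    the path to all-positive.  On a cycle the same $t$ works for all edges but
    the closing one; a particle crossing the closing edge goes from the last
    place to the first, which changes the sorting sign by $(-1)^{k-1}$.  So the
    same formula is a potential when the cycle has sign $(-1)^{k-1}$
    ([order_alternating]).  That sign is forced: the ratio of any potential to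
    the formula is constant on all configurations, because each configuration
    can be packed to the start of the order without using the closing edge
    ([wrap_edge_sign]).

    For $k = n-1$ a configuration is given by its single hole and a move
    transposes the hole with a particle, so alternation contributes $-1$ to each
    move.  Hence the exterior power is balanced if and only if the graph with
    all signs negated is ([hole_alternatingP]), which is the condition on even
    and odd cycles. *)

(** * Switching functions and balance *)

Definition is_sign (x : int) : Prop := x = 1 \/ x = -1.

Lemma is_signM x y : is_sign x -> is_sign y -> is_sign (x * y).
Proof. by case=> ->; case=> ->; rewrite /is_sign; [left|right|right|left]. Qed.

Lemma is_sign_sqr x : is_sign x -> x * x = 1.
Proof. by case=> ->. Qed.

Lemma is_sign_prod (I : Type) (r : seq I) (P : pred I) (F : I -> int) :
  (forall i, P i -> is_sign (F i)) -> is_sign (\prod_(i <- r | P i) F i).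
Proof. by move=> FP; apply: big_ind FP; [left|exact: is_signM]. Qed.

Lemma is_sign_exp n : is_sign ((-1) ^+ n).
Proof. by rewrite -signr_odd; case: odd; [right|left]. Qed.

Lemma map_next (T : eqType) (c : seq T) :
  uniq c -> [seq next c x | x <- c] = rot 1 c.
Proof.
case: c => [//|x p] Uc; apply: (@eq_from_nth _ x).
  by rewrite size_map size_rot.
move=> i; rewrite size_map => lti; rewrite (nth_map x) //.
rewrite next_nth mem_nth // index_uniq // rot1_cons nth_rcons.
by case: ltngtP => // [/ltnW ?|->]; rewrite nth_default.
Qed.

Section Potential.
Variables (V : finType) (S : signed_graph V).

Definition potential (t : V -> int) : Prop :=
  (forall x, is_sign (t x)) /\
  (forall x y, edge S x y -> esign S x y = t x * t y).

Lemma potential_balanced t : potential t -> balanced S.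
Proof.
case=> ts tE c [_ /andP[Cc Uc]]; rewrite /cycle_sign.
have -> : \prod_(x <- c) esign S x (next c x)
        = \prod_(x <- c) (t x * t (next c x)).
  apply: eq_big_seq => x xc; apply: tE; exact: next_cycle Cc xc.
rewrite big_split /= -(big_map (next c) xpredT t) map_next //.
rewrite (@perm_big _ _ _ _ (rot 1 c) c) /=; last by rewrite perm_rot.
by apply: is_sign_sqr; apply: is_sign_prod.
Qed.

Fixpoint walk_sign (x : V) (p : seq V) : int :=
  if p is y :: q then esign S x y * walk_sign y q else 1.

Lemma walk_sign_cat x p q :
  walk_sign x (p ++ q) = walk_sign x p * walk_sign (last x p) q.
Proof. by elim: p x => [|y p IH] x /=; rewrite ?mul1r // IH mulrA. Qed.

Lemma is_sign_walk x p : path (edge S) x p -> is_sign (walk_sign x p).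
Proof.
elim: p x => [|y p IH] x /=; first by left.
by case/andP=> /esign_pm1 xy /IH; apply: is_signM.
Qed.

Lemma walk_sign_prod x p :
  walk_sign x p = \prod_(z <- zip (x :: p) p) esign S z.1 z.2.
Proof.
elim: p x => [|y p IH] x; first by rewrite big_nil.
by rewrite /= big_cons -IH.
Qed.

Lemma cycle_sign_walk x p :
  uniq (x :: p) -> cycle_sign S (x :: p) = walk_sign x (rcons p x).
Proof.
move=> U; have zipE (s : seq V) f : zip s (map f s) = [seq (y, f y) | y <- s].
  by elim: s => //= y s ->.
rewrite walk_sign_prod /cycle_sign.
rewrite -(big_map (fun y => (y, next (x :: p) y)) xpredT
            (fun z => esign S z.1 z.2)) -zipE (map_next U) rot1_cons.
have zipr (s : seq V) t : size t = size s -> zip (rcons s x) t = zip s t.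
  by elim: s t => [|y s IH] [|z t] //= [/IH ->].
by rewrite -rcons_cons zipr ?size_rcons.
Qed.

(** A closed walk either visits its vertices once, and then it is a cycle (or
    goes back and forth along one edge), or it can be cut at a repeated vertex
    into two shorter closed walks. *)
Lemma balanced_closed_walk x p : balanced S ->
  path (edge S) x p -> last x p = x -> walk_sign x p = 1.
Proof.
move=> bS; have [m] := ubnP (size p); elim: m x p => // m IH x p ltm Pp Lp.
have [Up|/(uniqPn x)[i [j [ltij ltj eqij]]]] := boolP (uniq p).
  (* The last vertex is [x], so the closed walk is the cycle [x :: p]. *)
  case/lastP: p => [//|p z] in ltm Pp Lp Up *.
  rewrite last_rcons in Lp; subst z.
  have Up' : uniq (x :: p) by rewrite cons_uniq -rcons_uniq.
  case: p => [|y [|z p]] in ltm Pp Up Up' *.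
  - by move: Pp; rewrite /= edge_irr.
  - move: Pp => /= /andP[xy _].
    by rewrite mulr1 -(esign_sym xy) is_sign_sqr //; apply: esign_pm1.
  rewrite -cycle_sign_walk //; apply: bS; split=> //.
  by apply/andP; split.
set z := nth x p i in eqij.
have defp : p = take i p ++ z :: take (j - i.+1) (drop i.+1 p) ++ z :: drop j.+1 p.
  rewrite -{1}(cat_take_drop i p) (drop_nth x); last exact: ltn_trans ltj.
  rewrite -{1}(cat_take_drop (j - i.+1) (drop i.+1 p)) drop_drop subnK //.
  by rewrite (drop_nth x ltj) -eqij.
move: defp; move: (take i p) (take (j - _) _) (drop j.+1 p) => p1 p2 p3 defp.
move: Pp Lp ltm; rewrite {}defp {eqij ltj}; clearbody z.
rewrite !(cat_path, last_cat, size_cat) /= !(cat_path, last_cat, size_cat) /=.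
case/and5P=> P1 e1 P2 e2 P3 Lp ltm.
have W2 : walk_sign z (rcons p2 z) = 1.
  apply: IH; rewrite ?last_rcons ?rcons_path ?P2 ?size_rcons //; lia.
have W1 : walk_sign x (p1 ++ z :: p3) = 1.
  apply: IH; rewrite ?(last_cat, cat_path) /= ?P1 ?e1 ?size_cat /= //; lia.
move: W1 W2; rewrite -cats1 !walk_sign_cat /= walk_sign_cat /=.
move=> W1 W2; rewrite -W1 !mulrA; congr (_ * _); rewrite -!mulrA; congr (_ * _).
by rewrite mulrA -[X in _ * X]mulr1 -mulrA W2 ?mulr1.
Qed.

(** Switching functions characterise balance: on each component, the sign of
    any walk from a fixed root is a switching function. *)
Lemma balancedP : balanced S <-> exists t, potential t.
Proof.
split=> [bS|[t]]; last exact: potential_balanced.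
have csym : connect_sym (edge S) by apply: sym_connect_sym; exact: edge_sym.
have toP x : exists p, path (edge S) (fingraph.root (edge S) x) p /\
  last (fingraph.root (edge S) x) p = x.
  have /connectP[p Pp Lp] : connect (edge S) (fingraph.root (edge S) x) x.
    by rewrite csym connect_root.
  by exists p.
(* Walks back to the root make it unnecessary to reverse walks. *)
have fromP x : exists p, path (edge S) x p /\ last x p = fingraph.root (edge S) x.
  by have /connectP[p Pp Lp] := connect_root (edge S) x; exists p.
have [to /all_and2[Pto Lto]] := fin_all_exists toP.
have [fr /all_and2[Pfr Lfr]] := fin_all_exists fromP.
pose t x := walk_sign (fingraph.root (edge S) x) (to x).
have ts x : is_sign (t x) by exact: is_sign_walk.
have tfr x : t x * walk_sign x (fr x) = 1.
  rewrite -{2}(Lto x) -walk_sign_cat balanced_closed_walk //.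
    by rewrite cat_path Pto Lto Pfr.
  by rewrite last_cat Lto Lfr.
exists t; split=> // x y xy.
have rxy : fingraph.root (edge S) x = fingraph.root (edge S) y.
  by apply/eqP; rewrite (root_connect csym) connect1.
have : t x * (esign S x y * walk_sign y (fr y)) = 1.
  have -> : esign S x y * walk_sign y (fr y) = walk_sign x (y :: fr y) by [].
  rewrite -{2}(Lto x) -walk_sign_cat balanced_closed_walk //.
    by rewrite cat_path Pto Lto /= xy Pfr.
  by rewrite last_cat Lto /= Lfr.
move: (tfr y); case: (ts x) => ->; case: (ts y) => ->;
  case: (esign_pm1 xy) => ->; lia.
Qed.

End Potential.

(** * Labelled particles and the exterior power *)

Section Configurations.
Variables (V : finType) (k : nat).
Implicit Types (w : {ffun 'I_k -> V}) (s : 'S_k).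

Definition relabel w s : {ffun 'I_k -> V} := [ffun j => w (s j)].

Definition move w i y : {ffun 'I_k -> V} :=
  [ffun j => if j == i then y else w j].

Lemma relabel_inj w s : injective w -> injective (relabel w s).
Proof. by move=> winj a b; rewrite !ffunE => /winj/perm_inj. Qed.

Lemma move_inj w i y :
  injective w -> (forall j, w j != y) -> injective (move w i y).
Proof.
move=> winj wy a b; rewrite !ffunE.
have [->|ai] := eqVneq a i; have [->|bi] := eqVneq b i => //; last exact: winj.
- by move=> E; have := wy b; rewrite -E eqxx.
- by move=> E; have := wy a; rewrite E eqxx.
Qed.

Lemma relabel_sub w w' : injective w -> injective w' ->
  (forall i, exists j, w i = w' j) -> exists s, w = relabel w' s.
Proof.
move=> winj w'inj /fin_all_exists[f fE].
have finj : injective f by move=> a b ab; apply: winj; rewrite !fE ab.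
by exists (perm finj); apply/ffunP=> i; rewrite ffunE permE.
Qed.

(** The condition on a function of $k$ labelled particles that expresses a
    switching function of the exterior power, see [ext_balancedP].  Only
    injective tuples are configurations. *)
Definition alternating_potential (S : signed_graph V)
    (F : {ffun 'I_k -> V} -> int) : Prop :=
  [/\ forall w, injective w -> is_sign (F w),
      forall w s, injective w -> F (relabel w s) = (-1) ^+ s * F w
    & forall w i y, injective w -> (forall j, w j != y) ->
        edge S (w i) y -> F (move w i y) = F w * esign S (w i) y].

End Configurations.

Lemma sign_transfer (a b c x y : int) : is_sign c -> is_sign b -> is_sign a ->
  is_sign y -> is_sign x -> y * x * c = a * b -> y * b = x * a * c.
Proof. by case=> -> [] -> [] -> [] -> [] ->. Qed.

Section ExteriorPotential.
Variables (d : Order.disp_t) (V : finOrderType d) (S : signed_graph V) (k : nat).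
Implicit Types (w : {ffun 'I_k -> V}) (s : 'S_k) (u v : ext_vertex V k).

Lemma sorting w : injective w ->
  exists p : ext_vertex V k * 'S_k, w = relabel (finfun (ent p.1)) p.2.
Proof.
move=> winj; pose t := sort_tuple <=%O [tuple w i | i < k].
have st : sorted <%O t.
  by rewrite sort_lt_sorted map_inj_uniq ?enum_uniq.
pose u : ext_vertex V k := exist _ t st.
have [||s ->] := @relabel_sub _ _ w (finfun (ent u)) winj.
- by move=> a b; rewrite !ffunE => /ent_inj.
- move=> i; have /tnthP[j wj] : w i \in t by rewrite mem_sort map_f ?mem_enum.
  by exists j; rewrite ffunE.
by exists (u, s).
Qed.

Lemma sorting_unique u v s s' :
  relabel (finfun (ent u)) s = relabel (finfun (ent v)) s' -> (u, s) = (v, s').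
Proof.
move=> E; have Ej j : ent u (s j) = ent v (s' j).
  by have /ffunP/(_ j) := E; rewrite !ffunE.
have uv : u = v.
  apply/val_inj/val_inj; apply: lt_sorted_eq (proj2_sig u) (proj2_sig v) _ => x.
  apply/tnthP/tnthP => -[j ->].
    by exists (s' ((s^-1)%g j)); have := Ej ((s^-1)%g j); rewrite permKV.
  by exists (s ((s'^-1)%g j)); have := Ej ((s'^-1)%g j); rewrite permKV.
subst v; congr (_, _); apply/permP=> j; exact: ent_inj (Ej j).
Qed.

(** A $k$-set of vertices with a sign is the same as an ordered $k$-tuple up to
    even permutation, so a switching function of the exterior power unfolds to
    an alternating function of $k$ labelled particles that is multiplied by the
    sign of an edge when a particle moves along it. *)
Lemma ext_balancedP :
  balanced (exterior_power S k) <->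
  exists F : {ffun 'I_k -> V} -> int, alternating_potential S F.
Proof.
rewrite balancedP; split=> [[t [ts tE]]|[F [Fs Fa Fm]]]; last first.
  exists (fun u => F (finfun (ent u))).
  have uinj u : injective (finfun (ent u)).
    by move=> a b; rewrite !ffunE => /ent_inj.
  split=> [u|u v /existsP[[s i] wit]]; first exact: Fs.
  have := wit => /andP[/forallP /= H He].
  rewrite (ext_signE wit) /witness_sign /=.
  have -> : finfun (ent v) = move (relabel (finfun (ent u)) s) i (ent v i).
    apply/ffunP=> j; rewrite !ffunE; have [->//|ji] := eqVneq j i.
    by have /eqP <- := implyP (H j) ji.
  rewrite Fm ?Fa ?ffunE //; [|exact: relabel_inj|]; last first.
    by move=> j; rewrite !ffunE; exact: (ext_witness_notin wit).
  move: (is_sign_sqr (Fs _ (uinj u))) => FF.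
  by rewrite [X in _ = _ * (X * _)]mulrC !mulrA FF mul1r.
(* Sort the particles; by [sorting_unique] the choice of [p] is immaterial. *)
pose F w := if [pick p : ext_vertex V k * 'S_k |
                w == relabel (finfun (ent p.1)) p.2] is Some p
            then (-1) ^+ p.2 * t p.1 else 1.
have FE u s : F (relabel (finfun (ent u)) s) = (-1) ^+ s * t u.
  rewrite /F; case: pickP => [[v s'] /= /eqP/sorting_unique[-> ->] //|].
  by move/(_ (u, s)); rewrite eqxx.
exists F; split=> [w|w s|w i y] winj.
- have [[u s] ->] := sorting winj; rewrite FE.
  by apply: is_signM => //; apply: is_sign_exp.
- have [[u s'] ->] := sorting winj; rewrite FE.
  have -> : relabel (relabel (finfun (ent u)) s') s
          = relabel (finfun (ent u)) (s * s')%g.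
    by apply/ffunP=> j; rewrite !ffunE permM.
  by rewrite FE odd_permM signr_addb mulrA.
move=> wy; have [[u s] /= wE] := sorting winj.
have [[v s'] /= w'E] := sorting (move_inj (i := i) winj wy).
have uE j : w j = ent u (s j) by rewrite wE !ffunE.
have vE j : move w i y j = ent v (s' j) by rewrite w'E !ffunE.
move=> He.
have wit : ext_witness S u v ((s'^-1 * s)%g, s' i).
  apply/andP; split=> /=.
    apply/forallP=> j; apply/implyP => ji.
    have nj : (s'^-1)%g j != i by apply: contraNneq ji => <-; rewrite permKV.
    by rewrite permM -uE -{2}(permKV s' j) -vE ffunE (negPf nj).
  by rewrite permM permK -uE -vE ffunE eqxx.
have uv : edge (exterior_power S k) u v by apply/existsP; eexists; exact: wit.
have := tE _ _ uv; rewrite /= (ext_signE wit) /witness_sign /=.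
rewrite permM permK -uE -vE ffunE eqxx => E.
rewrite w'E wE !FE -wE odd_permM odd_permV signr_addb in E *.
move: E.
have := is_sign_exp s; have := is_sign_exp s'; have := ts u; have := ts v.
have := esign_pm1 He; rewrite -/(is_sign _).
move: (t u) (t v) (esign _ _ _) ((-1) ^+ s) ((-1) ^+ s'); exact: sign_transfer.
Qed.

End ExteriorPotential.

(** * Exchanging two particles on a claw *)

Section Fcons.
Variable V : finType.

Definition fcons k a (w : {ffun 'I_k -> V}) : {ffun 'I_k.+1 -> V} :=
  [ffun i => oapp w a (unlift ord0 i)].

Lemma fcons0 k a (w : {ffun 'I_k -> V}) : fcons a w ord0 = a.
Proof. by rewrite ffunE unlift_none. Qed.

Lemma fconsS k a (w : {ffun 'I_k -> V}) j : fcons a w (lift ord0 j) = w j.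
Proof. by rewrite ffunE liftK. Qed.

Lemma ffun_ordP k (w w' : {ffun 'I_k.+1 -> V}) :
  w ord0 = w' ord0 -> (forall j, w (lift ord0 j) = w' (lift ord0 j)) -> w = w'.
Proof. by move=> E0 ES; apply/ffunP=> i; case: (unliftP ord0 i) => [j|] ->. Qed.

Lemma fcons_neq k a b (w : {ffun 'I_k -> V}) :
  a != b -> (forall j, w j != b) -> forall i, fcons a w i != b.
Proof.
by move=> ab wb i; case: (unliftP ord0 i) => [j|] ->; rewrite ?fcons0 ?fconsS.
Qed.

Lemma fcons_inj k a (w : {ffun 'I_k -> V}) :
  injective w -> (forall j, w j != a) -> injective (fcons a w).
Proof.
move=> winj wa i j.
case: (unliftP ord0 i) => [i'|] ->; case: (unliftP ord0 j) => [j'|] -> //;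
  rewrite ?fcons0 ?fconsS.
- by move/winj->.
- by move=> E; have := wa i'; rewrite E eqxx.
- by move=> E; have := wa j'; rewrite E eqxx.
Qed.

Lemma move_fcons0 k a (w : {ffun 'I_k -> V}) y :
  move (fcons a w) ord0 y = fcons y w.
Proof. by apply: ffun_ordP => [|j]; rewrite ffunE ?eqxx /= ?fcons0 ?fconsS. Qed.

Lemma move_fconsS k a (w : {ffun 'I_k -> V}) i y :
  move (fcons a w) (lift ord0 i) y = fcons a (move w i y).
Proof.
apply: ffun_ordP => [|j]; rewrite ffunE /= ?fcons0 ?fconsS //.
by rewrite ffunE (inj_eq lift_inj).
Qed.

Lemma relabel_fcons k a (w : {ffun 'I_k -> V}) s :
  relabel (fcons a w) (lift0_perm s) = fcons a (relabel w s).
Proof.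
apply: ffun_ordP => [|j]; rewrite ffunE ?lift0_perm0 ?fcons0 //.
by rewrite lift0_perm_lift !fconsS ffunE.
Qed.

Lemma swap_fcons k a b (w : {ffun 'I_k -> V}) :
  relabel (fcons a (fcons b w)) (tperm ord0 (lift ord0 ord0))
  = fcons b (fcons a w).
Proof.
apply: ffun_ordP => [|j]; rewrite ffunE.
  by rewrite tpermL fconsS !fcons0.
case: (unliftP ord0 j) => [l|] ->; first by rewrite tpermD // !fconsS.
by rewrite tpermR fconsS !fcons0.
Qed.

Lemma injective_into k (A : {set V}) : (k <= #|A|)%N ->
  exists w : {ffun 'I_k -> V}, injective w /\ forall i, w i \in A.
Proof.
move=> leA; exists [ffun i => enum_val (widen_ord leA i)]; split=> [i j|i].
  by rewrite !ffunE => /enum_val_inj/(congr1 val)/= /val_inj.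
by rewrite ffunE enum_valP.
Qed.

End Fcons.

(** Two particles on leaves $a$, $b$ of a claw can be exchanged by using the
    third leaf as a siding.  This traverses each edge of the claw twice, so the
    signs cancel, whereas an alternating function must change sign. *)
Lemma no_claw (V : finType) (S : signed_graph V) k
    (F : {ffun 'I_k -> V} -> int) (a b c e : V) :
  alternating_potential S F -> (1 < k)%N -> (k + 2 <= #|V|)%N ->
  uniq [:: a; b; e] -> edge S c a -> edge S c b -> edge S c e -> False.
Proof.
case: k F => [|[|k]] // F [Fs Fa Fm] _ leV.
rewrite /= !inE negb_or andbT => /andP[/andP[ab ae] be] ca cb ce.
have nc x : edge S c x -> c != x.
  by apply: contraTneq => <-; rewrite edge_irr.
(* The other particles stay off the claw. *)
have [w [winj wA]] : exists w : {ffun 'I_k -> V},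
    injective w /\ forall i, w i \in ~: [set c; a; b; e].
  apply: injective_into; have := cardsC [set c; a; b; e].
  have : (#|[set c; a; b; e]| <= 4)%N; last lia.
  by rewrite -!setUA !cardsU1 cards1; do 3 case: (_ \notin _).
have wN x : x \in [set c; a; b; e] -> forall j, w j != x.
  by move=> xA j; apply: contraTneq (wA j) => ->; rewrite inE xA.
pose P x y := F (fcons x (fcons y w)).
pose ok x y := [&& x != y, x \in [set c; a; b; e] & y \in [set c; a; b; e]].
have inj2 x y : ok x y -> injective (fcons x (fcons y w)).
  case/and3P=> xy xA yA.
  apply: fcons_inj; last by apply: fcons_neq (wN _ xA); rewrite eq_sym.
  by apply: fcons_inj => //; exact: wN.
have m0 x y z : ok x y -> ok z y -> edge S x z -> P z y = P x y * esign S x z.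
  move=> xy zy xz; have := @Fm _ ord0 z (inj2 x y xy).
  rewrite move_fcons0 fcons0; apply=> //; case/and3P: zy => zy zA yA.
  have xnz : x != z by apply: contraTneq xz => ->; rewrite edge_irr.
  by apply: fcons_neq => //; apply: fcons_neq (wN _ zA); rewrite eq_sym.
have m1 x y z : ok x y -> ok x z -> edge S y z -> P x z = P x y * esign S y z.
  move=> xy xz yz; have := @Fm _ (lift ord0 ord0) z (inj2 x y xy).
  rewrite move_fconsS move_fcons0 fconsS fcons0; apply=> //.
  case/and3P: xz => xz xA zA.
  have ynz : y != z by apply: contraTneq yz => ->; rewrite edge_irr.
  by apply: fcons_neq => //; apply: fcons_neq (wN _ zA).
have okE x y : x \in [set c; a; b; e] -> y \in [set c; a; b; e] ->
    x != y -> ok x y by move=> xA yA xy; apply/and3P.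
have cA : c \in [set c; a; b; e] by rewrite !inE eqxx.
have aA : a \in [set c; a; b; e] by rewrite !inE eqxx ?orbT.
have bA : b \in [set c; a; b; e] by rewrite !inE eqxx ?orbT.
have eA : e \in [set c; a; b; e] by rewrite !inE eqxx ?orbT.
have [ba ea eb] : [/\ b != a, e != a & e != b] by rewrite !(eq_sym _ a) (eq_sym e).
have [nca ncb nce] : [/\ c != a, c != b & c != e] by rewrite !nc.
have [nac nbc nec] : [/\ a != c, b != c & e != c] by rewrite !(eq_sym _ c).
have [ac bc ec] : [/\ edge S a c, edge S b c & edge S e c].
  by rewrite !(edge_sym _ _ c).
(* The tour (a,b) (a,c) (a,e) (c,e) (b,e) (b,c) (b,a). *)
have s1 := m1 a b c (okE _ _ aA bA ab) (okE _ _ aA cA nac) bc.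
have s2 := m1 a c e (okE _ _ aA cA nac) (okE _ _ aA eA ae) ce.
have s3 := m0 a e c (okE _ _ aA eA ae) (okE _ _ cA eA nce) ac.
have s4 := m0 c e b (okE _ _ cA eA nce) (okE _ _ bA eA be) cb.
have s5 := m1 b e c (okE _ _ bA eA be) (okE _ _ bA cA nbc) ec.
have s6 := m1 b c a (okE _ _ bA cA nbc) (okE _ _ bA aA ba) ca.
have := Fa _ (tperm ord0 (lift ord0 ord0)) (inj2 a b (okE _ _ aA bA ab)).
rewrite swap_fcons odd_tperm /= expr1 -/(P b a) -/(P a b).
rewrite s6 s5 s4 s3 s2 s1 -(esign_sym ca) -(esign_sym cb) -(esign_sym ce).
have := Fs _ (inj2 a b (okE _ _ aA bA ab)); rewrite -/(P a b).
by case=> ->; case: (esign_pm1 ca) => ->; case: (esign_pm1 cb) => ->;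
  case: (esign_pm1 ce) => ->.
Qed.

(** * Sorting signs along a linear order *)

Section OrderSign.
Variables (V : finType) (g : V -> nat).
Hypothesis ginj : injective g.

Definition order_cmp (x y : V) : int := Num.sg ((g y)%:Z - (g x)%:Z).

Lemma order_cmpC x y : order_cmp y x = - order_cmp x y.
Proof. by rewrite /order_cmp -sgrN opprB. Qed.

Lemma is_sign_cmp x y : x != y -> is_sign (order_cmp x y).
Proof.
move=> xy; have : g x != g y by rewrite (inj_eq ginj).
rewrite /order_cmp; case: sgrP => //; [lia|by left|by right].
Qed.

Section Sign.
Variable k : nat.
Implicit Types (w : {ffun 'I_k -> V}) (s : 'S_k).

(** The sign of the permutation that sorts [w] by [g], as the sign of a
    Vandermonde determinant: this makes it alternating in [w], while
    [order_signE] shows how it depends on the comparison of two entries. *)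
Definition order_sign w : int :=
  Num.sg (\det (Vandermonde k (\row_i (g (w i))%:Z))).

Lemma order_sign_relabel w s :
  order_sign (relabel w s) = (-1) ^+ s * order_sign w.
Proof.
rewrite /order_sign.
have -> : Vandermonde k (\row_i (g (relabel w s i))%:Z)
        = col_perm s (Vandermonde k (\row_i (g (w i))%:Z)).
  by apply/matrixP=> i j; rewrite !mxE ffunE.
rewrite col_permE det_mulmx det_perm odd_permV sgrM mulrC; congr (_ * _).
by case: (odd_perm s).
Qed.

Lemma order_signE w :
  order_sign w = \prod_(i < k) \prod_(j < k | (i < j)%N) order_cmp (w i) (w j).
Proof.
rewrite /order_sign det_Vandermonde.
rewrite (big_morph _ (@sgrM int) (sgr1 _)); apply: eq_bigr => i _.
rewrite (big_morph _ (@sgrM int) (sgr1 _)); apply: eq_bigr => j _.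
by rewrite !mxE.
Qed.

Lemma is_sign_order w : injective w -> is_sign (order_sign w).
Proof.
move=> winj; rewrite order_signE; apply: is_sign_prod => i _.
apply: is_sign_prod => j ij; apply: is_sign_cmp.
by rewrite (inj_eq winj); apply: contraTneq ij => ->; rewrite ltnn.
Qed.

(** Exactly $k-1$ of the comparisons involve the moving entry. *)
Lemma order_sign_move w i y (e : int) :
  (forall j, j != i -> order_cmp y (w j) = e * order_cmp (w i) (w j)) ->
  order_sign (move w i y) = e ^+ k.-1 * order_sign w.
Proof.
move=> H; rewrite !order_signE.
pose c (a : 'I_k) : int := if a == i then e else 1.
have -> : e ^+ k.-1 = \prod_(a < k) \prod_(b < k | (a < b)%N) (c a * c b).
  under eq_bigr => a _ do rewrite big_split /=.
  rewrite big_split /= [X in _ * X](exchange_big_dep xpredT) //=.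
  rewrite (bigD1 i) //= [X in _ * _ * X](bigD1 i) //=.
  rewrite [X in _ * X * _]big1 ?[X in _ * (_ * X)]big1; last 2 first.
  - by move=> a /negPf ai; rewrite big1 // /c ai.
  - by move=> a /negPf ai; rewrite big1 // /c ai.
  rewrite /c eqxx !mulr1 !prodr_const -exprD; congr (_ ^+ _).
  have -> : k.-1 = #|predC1 i| by rewrite cardC1 card_ord.
  (* The labels after [i] and those before [i]. *)
  rewrite -(cardID [pred b : 'I_k | (i < b)%N] (predC1 i)).
  congr (_ + _)%N; apply: eq_card => b.
    by rewrite !inE /= -[b == i]/(b == i :> nat); case: ltngtP.
  by rewrite !inE -[b \in _]/(b < i)%N -[b == i]/(b == i :> nat); case: ltngtP.
rewrite -big_split /=; apply: eq_bigr => a _.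
rewrite -big_split /=; apply: eq_bigr => b ab.
rewrite !ffunE /c; have [ai|ai] := eqVneq a i; have [bi|bi] := eqVneq b i.
- by move: ab; rewrite ai bi ltnn.
- by rewrite ai mulr1 H.
- by rewrite bi mul1r order_cmpC H // [X in _ = _ * X]order_cmpC mulrN.
- by rewrite !mul1r.
Qed.

End Sign.

Variable (S : signed_graph V).

Lemma order_cmp_step x y z : g y = (g x).+1 -> z != x -> z != y ->
  order_cmp y z = order_cmp x z.
Proof.
move=> xy zx zy; have [gx gy] : g z != g x /\ g z != g y by rewrite !(inj_eq ginj).
by rewrite /order_cmp; case: sgrP; case: sgrP => //; lia.
Qed.

Lemma order_cmp_wrap x y z N : g x = 0%N -> g y = N -> (g z <= N)%N ->
  z != x -> z != y -> order_cmp y z = - order_cmp x z.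
Proof.
move=> gx gy zN zx zy.
have [nx ny] : g z != g x /\ g z != g y by rewrite !(inj_eq ginj).
by rewrite /order_cmp; case: sgrP; case: sgrP => //; lia.
Qed.

(** Edges between consecutive vertices form a forest, so they can be switched to
    positive: multiply the signs met from the bottom of the order. *)
Lemma linear_potential : exists t : V -> int, (forall x, is_sign (t x)) /\
  forall x y, edge S x y -> g y = (g x).+1 -> esign S x y = t x * t y.
Proof.
pose nxt x := odflt x [pick z | g z == (g x).+1].
pose s x := if edge S x (nxt x) then esign S x (nxt x) else 1.
have ss x : is_sign (s x) by rewrite /s; case: ifP => [/esign_pm1|]; last by left.
exists (fun x => \prod_(z | (g z < g x)%N) s z); split=> [x|x y xy gy].
  exact: is_sign_prod.
rewrite [X in _ = _ * X](bigD1 x) /= ?gy //.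
under [X in _ = _ * (_ * X)]eq_bigl => z.
  rewrite ltnS (_ : _ && _ = (g z < g x)%N); first over.
  by rewrite ltn_neqAle (inj_eq ginj) andbC.
rewrite mulrCA is_sign_sqr ?mulr1; last exact: is_sign_prod.
rewrite /s /nxt; case: pickP => [z|/(_ y)]; last by rewrite gy eqxx.
by rewrite -gy (inj_eq ginj) => /eqP->; rewrite /= xy.
Qed.

Variables (k N : nat) (t : V -> int).
Hypotheses (gN : forall x, (g x <= N)%N) (ts : forall x, is_sign (t x)).
Hypothesis tE : forall x y, edge S x y -> g y = (g x).+1 ->
  esign S x y = t x * t y.

Implicit Types (w : {ffun 'I_k -> V}) (s : 'S_k).

Definition order_potential (w : {ffun 'I_k -> V}) : int :=
  order_sign w * \prod_i t (w i).

Lemma is_sign_order_potential w : injective w -> is_sign (order_potential w).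
Proof. by move=> /is_sign_order ws; apply: is_signM => //; apply: is_sign_prod. Qed.

Lemma order_potential_relabel w s :
  order_potential (relabel w s) = (-1) ^+ s * order_potential w.
Proof.
rewrite /order_potential order_sign_relabel -mulrA; congr (_ * (_ * _)).
by rewrite [RHS](reindex_inj (@perm_inj _ s)); apply: eq_bigr => i _; rewrite ffunE.
Qed.

Lemma order_potential_move w i y (e : int) :
  (forall j, j != i -> order_cmp y (w j) = e * order_cmp (w i) (w j)) ->
  order_potential (move w i y)
  = order_potential w * (e ^+ k.-1 * (t (w i) * t y)).
Proof.
move=> H; rewrite /order_potential (order_sign_move H) -!mulrA mulrCA.
congr (_ * _); rewrite mulrCA; congr (_ * _).
rewrite (bigD1 i) //= [in RHS](bigD1 i) //= ffunE eqxx.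
under eq_bigr => j ji do rewrite ffunE (negPf ji).
rewrite [RHS]mulrC -!mulrA [RHS]mulrCA; congr (_ * _).
by rewrite mulrA is_sign_sqr ?mul1r.
Qed.

Lemma order_potential_step w i y : injective w -> (forall j, w j != y) ->
  edge S (w i) y -> g y = (g (w i)).+1 \/ g (w i) = (g y).+1 ->
  order_potential (move w i y) = order_potential w * esign S (w i) y.
Proof.
move=> winj wy xy gxy; rewrite (@order_potential_move _ _ _ 1).
  rewrite expr1n mul1r; congr (_ * _).
  case: gxy => gxy; first by rewrite (tE xy gxy).
  by rewrite esign_sym // (tE _ gxy) 1?edge_sym // mulrC.
move=> j ji; rewrite mul1r; have wji : w j != w i by rewrite (inj_eq winj).
by case: gxy => gxy; [|apply/esym]; apply: order_cmp_step.
Qed.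

Lemma order_potential_wrap w i y : injective w -> (forall j, w j != y) ->
  (g y = 0%N /\ g (w i) = N) \/ (g (w i) = 0%N /\ g y = N) ->
  order_potential (move w i y)
  = order_potential w * ((-1) ^+ k.-1 * (t (w i) * t y)).
Proof.
move=> winj wy gxy; apply: order_potential_move => j ji.
have wji : w j != w i by rewrite (inj_eq winj).
rewrite mulN1r; case: gxy => -[gx gy]; last exact: order_cmp_wrap gx gy _ _ _.
by rewrite (order_cmp_wrap gx gy) ?opprK.
Qed.

(** On a path no particle can overtake another one; on a cycle the order of the
    particles changes cyclically when one of them passes from the last vertex
    to the first, which is a permutation of sign $(-1)^{k-1}$. *)
Lemma order_alternating :
  (forall x y, edge S x y -> [\/ g y = (g x).+1, g x = (g y).+1 |
     ((g y = 0%N /\ g x = N) \/ (g x = 0%N /\ g y = N)) /\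
     esign S x y = (-1) ^+ k.-1 * (t x * t y)]) ->
  alternating_potential S order_potential.
Proof.
move=> gE; split=> [w|w s _|w i y winj wy xy].
- exact: is_sign_order_potential.
- exact: order_potential_relabel.
- case: (gE _ _ xy) => [gxy|gxy|[gxy ->]]; last exact: order_potential_wrap.
    by apply: order_potential_step => //; left.
  by apply: order_potential_step => //; right.
Qed.

End OrderSign.

(** * Packing configurations; the sign of the closing edge *)

Section Packing.
Variables (V : finType) (g : V -> nat) (k : nat).
Hypothesis ginj : injective g.
Hypothesis gdown : forall x m, (m < g x)%N -> exists y, g y = m.
Implicit Types (w : {ffun 'I_k -> V}).

Definition packed w : Prop :=
  forall i y, (g y < g (w i))%N -> exists j, w j = y.

(** The set occupied by a packed configuration is an initial segment of the
    order with $k$ elements, hence always the same set. *)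
Lemma packed_relabel w w' : injective w -> injective w' ->
  packed w -> packed w' -> exists s, w = relabel w' s.
Proof.
move=> winj w'inj pw pw'; apply: relabel_sub => // i.
have [/existsP[j /eqP]|/existsPn N] := boolP [exists j, w i == w' j].
  by exists j.
have lt j : (g (w' j) < g (w i))%N.
  have nij : g (w' j) != g (w i) by rewrite (inj_eq ginj) eq_sym.
  rewrite ltn_neqAle nij leqNgt; apply/negP => /pw'[l E].
  by have := N l; rewrite E eqxx.
have : (#|w i |: [set w' j | j : 'I_k]| <= #|[set w j | j : 'I_k]|)%N.
  apply/subset_leq_card/subsetP=> x /setU1P[->|/imsetP[j _ ->]].
    exact: imset_f.
  by have [l <-] := pw _ _ (lt j); exact: imset_f.
have wN : w i \notin [set w' j | j : 'I_k].
  by apply/imsetP=> -[j _ E]; have := N j; rewrite E eqxx.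
by rewrite cardsU1 wN !card_imset // ltnn.
Qed.

(** Every configuration can be packed at the bottom of the order by moving
    particles one step down, so two configurations differ by such moves, their inverses
    and a relabelling. *)
Lemma move_invariant_const (Q : {ffun 'I_k -> V} -> int) :
  (forall w s, injective w -> Q (relabel w s) = Q w) ->
  (forall w i y, injective w -> (forall j, w j != y) -> g (w i) = (g y).+1 ->
     Q (move w i y) = Q w) ->
  forall w w', injective w -> injective w' -> Q w = Q w'.
Proof.
move=> Qr Qm.
have pack w : injective w -> exists w', [/\ injective w', packed w' & Q w = Q w'].
  have [m] := ubnP (\sum_i g (w i)); elim: m w => // m IH w ltm winj.
  have [/existsP[i /existsP[z /andP[/eqP gz /existsPn wz]]]|/existsPn N] :=
      boolP [exists i, exists z, (g (w i) == (g z).+1) && ~~ [exists j, w j == z]].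
    have [||w' [w'inj pw' Qw']] := IH (move w i z); last 1 first.
    - by exists w'; split=> //; rewrite -Qw' Qm.
    - move: ltm; rewrite (bigD1 i) //= [in X in _ -> X](bigD1 i) //= ffunE eqxx gz.
      under [in X in _ -> X]eq_bigr => j ji do rewrite ffunE (negPf ji).
      by rewrite addSn.
    - exact: move_inj.
  (* Each occupied vertex has its predecessor occupied: descend from [w i]. *)
  exists w; split=> // i y; have [m'] := ubnP (g (w i) - g y).
  elim: m' i => // m' IH' i ltm' lty.
  have [z gz] : exists z, g z = (g (w i)).-1 by apply: (gdown (x := w i)); lia.
  have := N i; rewrite negb_exists => /forallP/(_ z).
  rewrite negb_and negbK gz prednK ?eqxx /=; last by lia.
  case/existsP=> j /eqP wj; have [/ginj yz|yz] := eqVneq (g y) (g z).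
    by exists j; rewrite wj.
  by apply: (IH' j); rewrite wj; lia.
move=> w w' /pack[v [vinj pv ->]] /pack[v' [v'inj pv' ->]].
have [s ->] := packed_relabel vinj v'inj pv pv'; exact: Qr.
Qed.

End Packing.

(** Compare an arbitrary alternating potential with the one built from the
    order: their ratio is constant, and moving one particle from the last vertex
    to the first computes the sign of the closing edge. *)
Lemma wrap_edge_sign (V : finType) (g : V -> nat) (S : signed_graph V) k N
    (t : V -> int) (F : {ffun 'I_k -> V} -> int) (a b : V) :
  injective g -> (forall x, (g x <= N)%N) ->
  (forall x m, (m < g x)%N -> exists y, g y = m) ->
  (forall x, is_sign (t x)) ->
  (forall x y, g y = (g x).+1 -> edge S x y) ->
  (forall x y, edge S x y -> g y = (g x).+1 -> esign S x y = t x * t y) ->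
  alternating_potential S F -> (0 < k < #|V|)%N ->
  edge S a b -> g a = N -> g b = 0%N -> esign S a b = (-1) ^+ k.-1 * (t a * t b).
Proof.
case: k F => // k F ginj gN gdown ts gE tE [Fs Fa Fm] ltk ab ga gb.
pose F0 := order_potential g t (k := k.+1).
have F0s (w : {ffun 'I_k.+1 -> V}) : injective w -> is_sign (F0 w).
  exact: is_sign_order_potential.
have F0r (w : {ffun 'I_k.+1 -> V}) s :
    F0 (relabel w s) = (-1) ^+ s * F0 w.
  exact: order_potential_relabel.
have ab' : a != b by apply: contraTneq ab => ->; rewrite edge_irr.
have Qconst : forall w w' : {ffun 'I_k.+1 -> V},
    injective w -> injective w' ->
    F w * F0 w = F w' * F0 w'.
  apply: (move_invariant_const ginj gdown (Q := fun w => F w * F0 w))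
    => [w s winj|w i y winj wy gwy].
    by rewrite Fa // F0r mulrACA is_sign_sqr ?mul1r //; exact: is_sign_exp.
  have wiy : edge S (w i) y by rewrite edge_sym gE.
  rewrite Fm // /F0 (order_potential_step (S := S) ginj ts tE) //; last by right.
  by rewrite mulrACA is_sign_sqr ?mulr1 //; exact: esign_pm1.
have [w [winj wA]] : exists w : {ffun 'I_k -> V},
    injective w /\ forall i, w i \in ~: [set a; b].
  apply: injective_into; have := cardsC [set a; b].
  rewrite cards2 ab' /= add2n => E.
  by rewrite -ltnS -ltnS E; case/andP: ltk.
have wa j : w j != a by apply: contraTneq (wA j) => ->; rewrite !inE eqxx.
have wb j : w j != b by apply: contraTneq (wA j) => ->; rewrite !inE eqxx orbT.
have w1inj := fcons_inj winj wa; have w1b := fcons_neq ab' wb.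
(* A particle at [a], with [b] free, crosses the closing edge. *)
have := Qconst _ _ (move_inj (i := ord0) w1inj w1b) w1inj.
rewrite Fm ?fcons0 // /F0 (order_potential_wrap ginj gN ts) ?fcons0 //; last by left.
rewrite mulrACA.
have := F0s _ w1inj; have := Fs _ w1inj; rewrite /F0.
have := ts a; have := ts b; have := is_sign_exp k; have := esign_pm1 ab.
move: (F _) (order_potential _ _ _) (t a) (t b) (_ ^+ _) (esign _ _ _).
move=> x y p q r z.
(* All quantities are signs: check the 64 cases. *)
by do 6![case=> ->].
Qed.

(** * Connected graphs without a claw *)

Lemma eq_ordS n (i j : 'I_n) :
  (j == ordS i) = (j == i.+1 :> nat) || ((i.+1 == n) && (j == 0 :> nat)).
Proof.
rewrite -val_eqE /=; have [E|ni] := eqVneq i.+1 n.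
  by rewrite {1}E modnn E (ltn_eqF (ltn_ord j)).
by rewrite modn_small ?orbF // ltn_neqAle ni ltn_ord.
Qed.

Section ClawFree.
Variables (V : finType) (G : simple_graph V).
Hypothesis conn : connected_graph G.
Hypothesis claw_free : forall c a b e : V, uniq [:: a; b; e] ->
  edge G c a -> edge G c b -> edge G c e -> False.

Lemma path_nth_edge x p z i : path (edge G) x p -> (i < size p)%N ->
  edge G (nth z (x :: p) i) (nth z (x :: p) i.+1).
Proof. by move/(pathP z)=> H /H. Qed.

Lemma inner_path_edge x p i y z : uniq (x :: p) -> path (edge G) x p ->
  (0 < i)%N -> (i < size p)%N -> edge G (nth z (x :: p) i) y ->
  y = nth z (x :: p) i.-1 \/ y = nth z (x :: p) i.+1.
Proof.
move=> Up Pp i0 ip iy.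
have [->|y1] := eqVneq y (nth z (x :: p) i.-1); first by left.
have [->|y2] := eqVneq y (nth z (x :: p) i.+1); first by right.
case: (@claw_free (nth z (x :: p) i) (nth z (x :: p) i.-1)
        (nth z (x :: p) i.+1) y) => //.
- have ne : nth z (x :: p) i.-1 != nth z (x :: p) i.+1.
    rewrite nth_uniq //; first by lia.
    by rewrite ltnS (leq_trans (leq_pred i)) // ltnW.
  by rewrite !cons_uniq !inE negb_or ne (eq_sym _ y) y1 eq_sym y2.
- rewrite edge_sym -{2}(prednK i0); apply: path_nth_edge => //.
  exact: leq_ltn_trans (leq_pred i) ip.
- exact: path_nth_edge.
Qed.

(** A vertex outside a longest path would be adjacent to an inner vertex of the
    path, which then is the centre of a claw. *)
Lemma claw_free_hamiltonian (x0 : V) : exists x p,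
  [/\ uniq (x :: p), path (edge G) x p & forall y, y \in x :: p].
Proof.
suff ext m (x : V) (p : seq V) : (#|V| - size p < m)%N ->
    uniq (x :: p) -> path (edge G) x p ->
    exists x p, [/\ uniq (x :: p), path (edge G) x p & forall y, y \in x :: p].
  exact: (ext _ x0 [::] (leqnn _)).
elim: m x p => // m IH x p ltm Up Pp.
have szp (q : seq V) : uniq q -> (size q <= #|V|)%N.
  by move=> Uq; rewrite -(card_uniqP Uq) max_card.
have [/forallP all_in|] := boolP [forall y, y \in x :: p]; first by exists x, p.
rewrite negb_forall => /existsP[y0 y0p].
have [z [y [zp yp zy]]] : exists z y,
    [/\ z \in x :: p, y \notin x :: p & edge G z y].
  have [/existsP[z /existsP[y /and3P[? ? ?]]]|N] :=
    boolP [exists z, exists y, [&& z \in x :: p, y \notin x :: p & edge G z y]].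
    by exists z, y.
  suff : closed (edge G) (mem (x :: p)).
    move/closed_connect/(_ _ _ (conn x y0)); rewrite !inE eqxx /= => E.
    by rewrite inE -E in y0p.
  apply: intro_closed; first by apply: sym_connect_sym; exact: edge_sym.
  move=> z y zy zp; apply: contraNT N => yp; apply/existsP; exists z.
  by apply/existsP; exists y; apply/and3P.
have Uyp : uniq (y :: x :: p) by rewrite cons_uniq yp.
have lt_size : (#|V| - (size p).+1 < m)%N.
  by rewrite subnS -ltnS prednK // subn_gt0; exact: ltnW (szp _ Uyp).
have [zx|zx] := eqVneq z x.
  by apply: (IH y (x :: p)) => //; rewrite /= -[x in edge G y x]zx edge_sym zy.
have [zl|zl] := eqVneq z (last x p).
  apply: (IH x (rcons p y)); rewrite ?size_rcons //.
    by rewrite -rcons_cons rcons_uniq yp Up.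
  by rewrite rcons_path Pp -zl zy.
have ltz : (index z (x :: p) < size p)%N.
  move: zp; rewrite -index_mem /= ltnS leq_eqVlt => /orP[/eqP E|//].
  case/eqP: zl; rewrite (last_nth z) -E -[X in nth _ _ X]/(index z (x :: p)).
  by rewrite nth_index // -index_mem /= E.
have z0 : (0 < index z (x :: p))%N by rewrite /= eq_sym (negPf zx).
have := @inner_path_edge x p _ y z Up Pp z0 ltz.
rewrite nth_index // => /(_ zy)[] E; case/negP: yp; rewrite E mem_nth //.
by rewrite ltnS (leq_trans (leq_pred _) (ltnW ltz)).
Qed.

(** On a spanning path only the two end vertices can have another neighbour,
    namely each other. *)
Lemma claw_free_path_or_cycle (x0 : V) : (2 < #|V|)%N ->
  is_path_graph G \/ is_cycle_graph G.
Proof.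
move=> V3; have [x [p [Up Pp all_in]]] := claw_free_hamiltonian x0.
have szp : size (x :: p) = #|V|.
  by rewrite -(card_uniqP Up); apply: eq_card => y; rewrite all_in.
have ltp a : (a.+1 < #|V|)%N -> (a < size p)%N by rewrite -szp.
pose v i := nth x (x :: p) i.
pose f (i : 'I_#|V|) := v i.
have finj : injective f.
  move=> i j /eqP; rewrite nth_uniq ?szp ?ltn_ord // => /eqP; exact: val_inj.
have fbij : bijective f by apply: inj_card_bij; rewrite ?card_ord.
have step i : (i.+1 < #|V|)%N -> edge G (v i) (v i.+1).
  by rewrite -szp => lti; apply: path_nth_edge.
have ends i j : (i < j < #|V|)%N -> edge G (v i) (v j) ->
    j = i.+1 \/ (i = 0%N /\ j.+1 = #|V|).
  move=> /andP[ij jV] vij.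
  have vK a b : (a < #|V|)%N -> (b < #|V|)%N -> v a = v b -> a = b.
    by move=> aV bV /eqP; rewrite nth_uniq ?szp // => /eqP.
  have [i0|i0] := posnP i; last first.
    case: (@inner_path_edge x p i (v j) x Up Pp) => //;
      [by apply: ltp; lia|by move/vK; lia|by move/vK; lia].
  have [jl|jl] := eqVneq j.+1 #|V|; first by right.
  case: (@inner_path_edge x p j (v i) x Up Pp) => //;
    [lia|by apply: ltp; lia|by rewrite edge_sym|by move/vK; lia|by move/vK; lia].
have fE i j : edge G (f i) (f j) =
    [|| i.+1 == j :> nat, j.+1 == i :> nat |
     edge G (v 0%N) (v #|V|.-1) &&
     ((i == 0%N :> nat) && (j.+1 == #|V|) || (j == 0%N :> nat) && (i.+1 == #|V|))].
  wlog ij : i j / (i <= j)%N => [H|].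
    have [/H//|/ltnW/H] := leqP i j.
    by rewrite edge_sym => ->; rewrite orbCA [X in _ && X]orbC.
  have [/val_inj <-|nij] := eqVneq (i : nat) j.
    rewrite edge_irr; apply/esym/negbTE; move: (ltn_ord i) V3.
    by case: (edge _ _ _) => /=; lia.
  have ltij : (i < j < #|V|)%N by rewrite ltn_neqAle nij ij ltn_ord.
  apply/idP/idP=> [eij|/or3P[/eqP E|/eqP E|/andP[e0 /orP[]/andP[/eqP E1 /eqP E2]]]].
  - have [->|[i0 jl]] := ends i j ltij eij; first by rewrite eqxx.
    have -> : #|V|.-1 = j by rewrite -{1}jl.
    by rewrite -i0 eij jl !eqxx !orbT.
  - by rewrite /f -E; apply: step; rewrite E ltn_ord.
  - by move: ltij; rewrite -E; lia.
  - by rewrite /f E1; have <- : #|V|.-1 = j by rewrite -{1}E2.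
  - by move: ltij; rewrite E1; lia.
have [e0|e0] := boolP (edge G (v 0%N) (v #|V|.-1)); [right|left].
  split=> //; exists f; split=> // i j; rewrite fE e0 !eq_ordS /=.
  by rewrite ![_.+1 == _]eq_sym; do !case: (_ == _).
by exists f; split=> // i j; rewrite fE (negPf e0) orbF.
Qed.

End ClawFree.

(** * One hole *)

Section Negation.
Variables (V : finType) (S : signed_graph V).

Lemma neg_esign_sym x y : edge S x y -> - esign S x y = - esign S y x.
Proof. by move/esign_sym->. Qed.

Lemma neg_esign_pm1 x y :
  edge S x y -> - esign S x y = 1 \/ - esign S x y = -1.
Proof. by move/esign_pm1=> [->|->]; [right|left]. Qed.

Definition neg_graph : signed_graph V :=
  SignedGraph (graph := graph S) neg_esign_sym neg_esign_pm1.

Lemma cycle_sign_neg c :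
  cycle_sign neg_graph c = (-1) ^+ size c * cycle_sign S c.
Proof.
rewrite /cycle_sign /=; move: (next c) => f.
elim: c => [|x c IH]; first by rewrite !big_nil mul1r.
by rewrite !big_cons IH exprS mulN1r !mulNr mulrCA.
Qed.

Lemma balanced_neg : balanced neg_graph <->
  (forall c : seq V, graph_cycle S c ->
     (~~ odd (size c) -> cycle_sign S c = 1) /\
     (odd (size c) -> cycle_sign S c = -1)).
Proof.
split=> [bS c Cc|H c Cc].
  have := bS c Cc; rewrite cycle_sign_neg -signr_odd.
  by case: odd => /=; rewrite ?mulN1r ?mul1r => E; split=> // _; rewrite -E opprK.
rewrite cycle_sign_neg -signr_odd; have [He Ho] := H c Cc.
case: (boolP (odd (size c))) => [/Ho ->|/He ->] //.
Qed.

End Negation.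

Section Hole.
Variables (V : finType) (S : signed_graph V) (k : nat).
Hypothesis cardV : #|V| = k.+1.
Implicit Types (w : {ffun 'I_k -> V}).

Let g (x : V) : nat := enum_rank x.

Let ginj : injective g.
Proof. by move=> x y /val_inj/enum_rank_inj. Qed.

Definition is_hole w (h : V) : bool := [forall j, w j != h].

Lemma hole_unique w h h' :
  injective w -> is_hole w h -> is_hole w h' -> h = h'.
Proof.
move=> winj /forallP wh /forallP wh'; apply/eqP; apply: contraT => hh'.
have := leq_card _ (fcons_inj (fcons_inj winj wh) (fcons_neq hh' wh')).
by rewrite card_ord cardV ltnn.
Qed.

Lemma hole_exists w : exists h, is_hole w h.
Proof.
have [x /imsetP xw] : exists x, x \notin [set w j | j : 'I_k].
  apply/existsP; rewrite -negb_forall; apply/forallP=> all_in.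
  have := leq_imset_card w 'I_k; rewrite card_ord leqNgt.
  have -> : [set w j | j in 'I_k] = setT by apply/setP=> x; rewrite all_in inE.
  by rewrite cardsT cardV ltnSn.
by exists x; apply/forallP=> j; apply/eqP=> E; apply: xw; exists j.
Qed.

Lemma hole_move w i y : injective w -> is_hole w y -> is_hole (move w i y) (w i).
Proof.
move=> winj /forallP wy; apply/forallP=> j; rewrite ffunE.
by have [_|ji] := eqVneq j i; rewrite ?(inj_eq winj) // eq_sym.
Qed.

Lemma hole_mem w h x : injective w -> is_hole w h -> x != h -> exists j, w j = x.
Proof.
move=> winj wh xh.
have [/existsP[j /eqP wj]|/existsPn N] := boolP [exists j, w j == x].
  by exists j.
by case/eqP: xh; apply: hole_unique winj _ wh; apply/forallP.
Qed.

Lemma hole_relabel w w' h : injective w -> injective w' ->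
  is_hole w h -> is_hole w' h -> exists s, w = relabel w' s.
Proof.
move=> winj w'inj wh w'h; apply: relabel_sub => // i.
have [j wj] := hole_mem w'inj w'h (forallP wh i).
by exists j.
Qed.

(** The hole counts as one more particle, so that all vertices are occupied and
    every move becomes a permutation. *)
Definition hole_sign h w : int := order_sign g (fcons h w).

Lemma is_sign_hole h w : injective w -> is_hole w h -> is_sign (hole_sign h w).
Proof.
by move=> winj /forallP wh; apply: is_sign_order => //; apply: fcons_inj.
Qed.

Lemma hole_sign_relabel h w s :
  hole_sign h (relabel w s) = (-1) ^+ s * hole_sign h w.
Proof.
rewrite /hole_sign -relabel_fcons order_sign_relabel.
by rewrite /lift0_perm odd_lift_perm.
Qed.

(** The move transposes the entries $0$ and $i+1$ of the tuple headed by the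
    hole. *)
Lemma hole_sign_move w i y :
  hole_sign (w i) (move w i y) = - hole_sign y w.
Proof.
rewrite /hole_sign -mulN1r.
have -> : fcons (w i) (move w i y)
        = relabel (fcons y w) (tperm ord0 (lift ord0 i)).
  apply: ffun_ordP => [|j]; rewrite [RHS]ffunE.
    by rewrite tpermL fcons0 fconsS.
  rewrite fconsS ffunE; have [->|ji] := eqVneq j i.
    by rewrite tpermR fcons0.
  by rewrite tpermD ?fconsS // (inj_eq lift_inj) eq_sym.
by rewrite order_sign_relabel odd_tperm.
Qed.

(** With all vertices but one occupied a configuration is determined, up to
    relabelling, by its hole, and a move transposes the hole with a particle:
    the $(n-1)$st power is the graph itself with all signs reversed, up to
    switching. *)
Lemma hole_alternatingP :
  (exists F : {ffun 'I_k -> V} -> int, alternating_potential S F) <->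
  balanced (neg_graph S).
Proof.
rewrite balancedP; split=> [[F [Fs Fa Fm]]|[t [ts tE]]].
  (* Choose a configuration for each hole; by [hole_relabel] the value assigned
     to the hole does not depend on the choice. *)
  have conf h : exists w : {ffun 'I_k -> V}, injective w /\ is_hole w h.
    have [|w [winj wA]] := @injective_into V k [set~ h].
      by have := cardsC1 h; rewrite cardV => ->.
    by exists w; split=> //; apply/forallP=> j; have := wA j; rewrite !inE.
  have [cf /all_and2[cinj ch]] := fin_all_exists conf.
  exists (fun h => F (cf h) * hole_sign h (cf h)); split=> [h|x y xy].
    by apply: is_signM; [exact: Fs|exact: is_sign_hole].
  have xny : x != y by apply: contraTneq xy => ->; rewrite edge_irr.
  have [i wi] := hole_mem (cinj y) (ch y) xny.
  have := hole_move i (cinj y) (ch y); rewrite wi => w'h.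
  have w'inj := move_inj (i := i) (cinj y) (forallP (ch y)).
  have [s w'E] := hole_relabel w'inj (cinj x) w'h (ch x).
  have := Fm _ i y (cinj y) (forallP (ch y)); rewrite wi => /(_ xy).
  have := hole_sign_move (cf y) i y; rewrite wi w'E Fa // hole_sign_relabel.
  have := @esign_pm1 _ S _ _ xy; have := is_sign_exp s.
  have := Fs _ (cinj x); have := Fs _ (cinj y).
  have := is_sign_hole (cinj x) (ch x); have := is_sign_hole (cinj y) (ch y).
  rewrite /=.
  move: (F _) (F _) (hole_sign _ _) (hole_sign _ _) (_ ^+ _) (esign _ _ _).
  by move=> a b c e r z; do 6![case=> ->].
pose F w := if [pick h | is_hole w h] is Some h then t h * hole_sign h w else 1.
have FE w h : injective w -> is_hole w h -> F w = t h * hole_sign h w.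
  move=> winj wh; rewrite /F; case: pickP => [h' wh'|/(_ h)]; last by rewrite wh.
  by rewrite (hole_unique winj wh' wh).
exists F; split=> [w winj|w s winj|w i y winj /forallP wy xy].
- have [h wh] := hole_exists w; rewrite (FE _ _ winj wh).
  by apply: is_signM => //; exact: is_sign_hole.
- have [h wh] := hole_exists w.
  rewrite (FE _ _ winj wh) (FE _ h (relabel_inj winj)).
    by rewrite hole_sign_relabel mulrCA.
  by apply/forallP=> j; rewrite ffunE (forallP wh).
have w'inj := move_inj (i := i) winj (forallP wy).
rewrite (FE _ _ winj wy) (FE _ _ w'inj (hole_move i winj wy)) hole_sign_move.
have := tE _ _ xy; have := esign_pm1 xy; have := ts y; have := ts (w i).
rewrite /=; move: (t y) (t (w i)) (esign _ _ _) (hole_sign _ _) => a b z e.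
by do 3![case=> ->]; rewrite ?mulrN1 ?mulN1r ?mulr1 ?mul1r ?opprK.
Qed.

End Hole.

(** * Paths and cycles *)

Section PathsAndCycles.
Variables (V : finType) (S : signed_graph V) (k : nat).

Lemma path_alternating : is_path_graph S ->
  exists F : {ffun 'I_k -> V} -> int, alternating_potential S F.
Proof.
case=> f [[h fK hK] fE]; pose g x := nat_of_ord (h x).
have ginj : injective g by move=> x y /val_inj/(can_inj hK).
have [t [ts tE]] := linear_potential ginj S.
have gN x : (g x <= #|V|)%N by exact: ltnW (ltn_ord (h x)).
exists (order_potential g t); apply: (order_alternating ginj gN ts tE) => x y.
rewrite -{1}(hK x) -{1}(hK y) fE => /orP[] /eqP E.
  by constructor 1.
by constructor 2.
Qed.

Hypothesis ltk : (0 < k < #|V|)%N.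

(** With signs normalised to $+$ along the cycle except on one edge, the sign
    of that edge both decides balance and is forced by the particles. *)
Lemma cycle_alternatingP : is_cycle_graph S ->
  (exists F : {ffun 'I_k -> V} -> int, alternating_potential S F) <->
  ((odd k -> balanced S) /\ (~~ odd k -> unbalanced S)).
Proof.
case=> V3 [f [[h fK hK] fE]]; pose g x := nat_of_ord (h x).
have ginj : injective g by move=> x y /val_inj/(can_inj hK).
have gltV x : (g x < #|V|)%N by exact: ltn_ord.
pose N := #|V|.-1.
have VN : #|V| = N.+1 by rewrite /N prednK //; lia.
have gN x : (g x <= N)%N by rewrite -ltnS -VN.
have gK m : (m < #|V|)%N -> exists y, g y = m.
  by move=> lem; exists (f (Ordinal lem)); rewrite /g fK.
have gdown x m : (m < g x)%N -> exists y, g y = m.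
  by move=> lem; apply: gK; exact: ltn_trans lem _.
have gE x y : edge S x y = (g y == (g x).+1) || ((g x).+1 == #|V|) && (g y == 0%N)
    || ((g x == (g y).+1) || ((g y).+1 == #|V|) && (g x == 0%N)).
  by rewrite -{1}(hK x) -{1}(hK y) fE !eq_ordS.
have [t [ts tE]] := linear_potential ginj S.
have [a ga] : exists y, g y = N by apply: gK; rewrite VN.
have [b gb] : exists y, g y = 0%N by apply: gK; rewrite VN.
have ab : edge S a b by rewrite gE ga gb VN !eqxx orbT.
have step x y : g y = (g x).+1 -> edge S x y by move=> E; rewrite gE E eqxx.
have sab := esign_pm1 ab.
have wrap x y : (g x).+1 == #|V| -> g y == 0%N -> x = a /\ y = b.
  rewrite VN eqSS => /eqP gx /eqP gy.
  by split; apply: ginj; rewrite ?gx ?gy ?ga ?gb.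
have Fiff : (exists F : {ffun 'I_k -> V} -> int, alternating_potential S F) <->
    esign S a b = (-1) ^+ k.-1 * (t a * t b).
  split=> [[F FP]|E].
    exact: (wrap_edge_sign ginj gN gdown ts step tE FP ltk ab ga gb).
  exists (order_potential g t); apply: (order_alternating ginj gN ts tE) => x y.
  rewrite gE => /orP[/orP[/eqP|/andP[gx gy]]|/orP[/eqP|/andP[gy gx]]].
  - by constructor 1.
  - by have [-> ->] := wrap _ _ gx gy; constructor 3; split=> //; left.
  - by constructor 2.
  - have [-> ->] := wrap _ _ gy gx; constructor 3; split; first by right.
    by rewrite -(esign_sym ab) E [t b * _]mulrC.
have biff : balanced S <-> esign S a b = t a * t b.
  split=> [/balancedP[t' [ts' tE']]|E]; last first.
    apply: (@potential_balanced _ _ t); split=> // x y.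
    rewrite gE => /orP[/orP[/eqP gxy|/andP[gx gy]]|/orP[/eqP gxy|/andP[gy gx]]].
    - by apply: tE => //; exact: step.
    - by have [-> ->] := wrap _ _ gx gy.
    - have yx := step _ _ gxy; rewrite -(esign_sym yx) mulrC; exact: tE.
    - have [-> ->] := wrap _ _ gy gx.
      by rewrite -(esign_sym ab) E mulrC.
  (* The ratio of two switching functions is constant along the cycle cut open
     at the edge [a b]. *)
  have const x : t x * t' x = t b * t' b.
    have [m] := ubnP (g x); elim: m x => // m IH x ltm.
    have [gx|gx] := posnP (g x); first by rewrite (ginj x b) // gx.
    have [y gy] : exists y, g y = (g x).-1 by apply: (@gdown x); lia.
    have gxy : g x = (g y).+1 by rewrite gy prednK.
    rewrite -(IH y); last by lia.
    have yx := step _ _ gxy.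
    have := tE' _ _ yx; rewrite (tE _ _ yx gxy).
    have := ts x; have := ts y; have := ts' x; have := ts' y.
    move: (t x) (t y) (t' x) (t' y) => p q r s.
    by do 4![case=> ->].
  have := const a; rewrite (tE' _ _ ab).
  have := ts a; have := ts b; have := ts' a; have := ts' b.
  move: (t a) (t b) (t' a) (t' b) => p q r s.
  by do 4![case=> ->].
rewrite Fiff /unbalanced biff; have k0 : (0 < k)%N by case/andP: ltk.
rewrite -(prednK k0) /= negbK -signr_odd.
have : is_sign (t a * t b) by exact: is_signM.
move: (t a * t b) sab => r sab rs; case: (odd _) => /=; rewrite ?mulN1r ?mul1r.
  split=> [E|[_ /(_ isT)]]; last by case: sab => ->; case: rs => ->.
  by split=> // _; rewrite E; case: rs => ->.
by split=> [E|[/(_ isT)]].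
Qed.

End PathsAndCycles.

Theorem theorem1 (d : Order.disp_t) (V : finOrderType d) (S : signed_graph V)
    (n : nat) (hn : #|V| = n) (hconn : connected_graph S) :
  (forall k : nat, (2 <= k <= n - 2)%N ->
     (balanced (exterior_power S k) <->
        (is_path_graph S \/
         (is_cycle_graph S /\
          (odd k -> balanced S) /\ (~~ odd k -> unbalanced S)))))
  /\
  ((2 <= n)%N ->
     (balanced (exterior_power S (n - 1)) <->
        (forall c : seq V, graph_cycle S c ->
           (~~ odd (size c) -> cycle_sign S c = 1) /\
           (odd (size c) -> cycle_sign S c = -1)))).
Proof.
split=> [k /andP[k2 kn]|n2].
  have ltk : (0 < k < #|V|)%N by rewrite hn; lia.
  rewrite ext_balancedP; split=> [[F FP]|[|[Cg]]]; last first.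
  - by move/(cycle_alternatingP ltk Cg).
  - exact: path_alternating.
  have [x0 _] : exists x0 : V, x0 \in V by apply/card_gt0P; rewrite hn; lia.
  have [||Pg|Cg] := @claw_free_path_or_cycle V S hconn _ x0.
  - move=> c a b e; apply: (no_claw FP) => //; rewrite hn; lia.
  - by rewrite hn; lia.
  - by left.
  - by right; split=> //; apply/(cycle_alternatingP ltk Cg); exists F.
rewrite ext_balancedP -balanced_neg hole_alternatingP //.
by rewrite hn subn1 prednK //; exact: ltnW.
Qed.
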